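(* Let $p$ be a prime, $n\ge 1$ an integer, and $F=GF(p^n)$. Let \[ A(n,p)=\left\{v(a,b,c)=\begin{bmatrix}1&0&0\\ a&1&0\\ b&c&1\end{bmatrix} : a,b,c\in F\right\}, \] a group under matrix multiplication. Then \[ M_1(\mathcal{C}(A(n,p)))=p^n(p^{2n}-1)(p^{2n}-p^n-1)^2,\qquad M_2(\mathcal{C}(A(n,p)))=\frac{p^n(p^{2n}-1)(p^{2n}-p^n-1)^3}{2}, \] \[ M_1(\mathcal{NC}(A(n,p)))=p^{8n}(p^n-2)+p^{5n}(2p^n-1), \] \[ M_2(\mathcal{NC}(A(n,p)))=\frac{(p^{3n}-p^n)\left[p^{8n}(p^n-3)+p^{6n}(3p^n-1)\right]}{2}. \] Further, for $\Gamma(A(n,p))=\mathcal{C}(A(n,p))$ and for $\Gamma(A(n,p))=\mathcal{NC}(A(n,p))$, \[ \frac{M_2(\Gamma(A(n,p)))}{|e(\Gamma(A(n,p)))|}=\frac{M_1(\Gamma(A(n,p)))}{|v(\Gamma(A(n,p)))|}. \]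
   Context: For a finite simple undirected graph $\Gamma$ with vertex set $v(\Gamma)$ and edge set $e(\Gamma)$, the first and second Zagreb indices are $M_1(\Gamma)=\sum_{v\in v(\Gamma)}\deg(v)^2$ and $M_2(\Gamma)=\sum_{uv\in e(\Gamma)}\deg(u)\deg(v)$. For a finite non-abelian group $G$ with center $Z(G)$, the commuting graph $\mathcal{C}(G)$ is the simple graph with vertex set $G\setminus Z(G)$ in which two distinct vertices $x,y$ are adjacent iff $xy=yx$; the non-commuting graph $\mathcal{NC}(G)$ is the complement of $\mathcal{C}(G)$ (same vertex set, distinct $x,y$ adjacent iff $xy\ne yx$). $GF(q)$ is the finite field with $q$ elements. *)

(* Defs.v *)
From HB Require Import structures.
From mathcomp Require Import all_boot all_order all_algebra all_fingroup all_solvable.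

Set Implicit Arguments.
Unset Strict Implicit.
Unset Printing Implicit Defensive.

Import GroupScope GRing.Theory.

Record sgraph := SGraph {
  svertex :> finType;
  sadj : rel svertex;
  sadj_sym : symmetric sadj;
  sadj_irrefl : irreflexive sadj
}.

Definition sdeg (Gam : sgraph) (x : Gam) : nat := #|[set y | sadj x y]|.

(* An edge is the unordered pair {x, y} of its endpoints, so each edge is
   counted once. *)
Definition sedges (Gam : sgraph) : {set {set Gam}} :=
  [set [set x; y] | x in Gam, y in Gam & sadj x y].

Definition zagreb1 (Gam : sgraph) : nat := (\sum_(x : Gam) sdeg x ^ 2)%N.

(* Adjacency is irreflexive, so every e in sedges Gam has exactly two elements
   and the inner product is deg(u) deg(v) for e = uv. *)
Definition zagreb2 (Gam : sgraph) : nat :=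
  (\sum_(e in sedges Gam) \prod_(x in e) sdeg x)%N.

Section Complement.
Variable Gam : sgraph.

Definition compl_adj : rel Gam := [rel x y | (x != y) && ~~ sadj x y].

Fact compl_adj_sym : symmetric compl_adj.
Proof. by move=> x y; rewrite /compl_adj /= eq_sym sadj_sym. Qed.

Fact compl_adj_irrefl : irreflexive compl_adj.
Proof. by move=> x; rewrite /compl_adj /= eqxx. Qed.

Definition complement : sgraph := SGraph compl_adj_sym compl_adj_irrefl.
End Complement.

Section CommutingGraph.
Variables (gT : finGroupType) (G : {group gT}).

Definition noncentral : finType := {x : gT | x \in G :\: 'Z(G)}.

Definition commuting_adj : rel noncentral :=
  [rel x y | (x != y) && (val x * val y == val y * val x)].

Fact commuting_adj_sym : symmetric commuting_adj.
Proof. by move=> x y; rewrite /commuting_adj /= eq_sym [_ * _ == _]eq_sym. Qed.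

Fact commuting_adj_irrefl : irreflexive commuting_adj.
Proof. by move=> x; rewrite /commuting_adj /= eqxx. Qed.

Definition commuting_graph : sgraph :=
  SGraph commuting_adj_sym commuting_adj_irrefl.

Definition noncommuting_graph : sgraph := complement commuting_graph.
End CommutingGraph.

Section GroupA.
Variable F : finFieldType.

Definition vmx (a b c : F) : 'M[F]_3 :=
  (\matrix_(i, j) nth 0 (nth [::] [:: [:: 1; 0; 0];
                                      [:: a; 1; 0];
                                      [:: b; c; 1]] i) j)%R.

Definition A_set : {set {'GL_3[F]}} :=
  [set g : {'GL_3[F]} | [exists a, exists b, exists c, GLval g == vmx a b c]].

Fact vmx1 : (vmx 0 0 0 = 1%:M)%R.
Proof.
by apply/matrixP=> -[[|[|[|//]]] ?] [[|[|[|//]]] ?]; rewrite !mxE.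
Qed.

Fact vmxM a b c a' b' c' :
  (vmx a b c *m vmx a' b' c' = vmx (a + a') (b + c * a' + b') (c + c'))%R.
Proof.
apply/matrixP=> -[[|[|[|//]]] ?] [[|[|[|//]]] ?];
  rewrite !mxE !big_ord_recl big_ord0 !mxE /=;
  by rewrite !(mul0r, mulr0, mul1r, mulr1, add0r, addr0, addrA).
Qed.

Fact A_group_set : group_set A_set.
Proof.
apply/group_setP; split=> [|x y].
  rewrite inE; do 3!(apply/existsP; exists 0%R).
  by rewrite GL_1E vmx1.
rewrite !inE => /existsP[a /existsP[b /existsP[c /eqP vx]]].
move=> /existsP[a' /existsP[b' /existsP[c' /eqP vy]]].
apply/existsP; exists (a + a')%R; apply/existsP; exists (b + c * a' + b')%R.
by apply/existsP; exists (c + c')%R; rewrite GL_ME vx vy -vmxM.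
Qed.

Canonical A_group : {group {'GL_3[F]}} := Group A_group_set.
End GroupA.

(* Main.v *)
(** The noncentral elements of A(n,p) all have centralizers of order q^2, where
    q = p^n: a matrix v(a,b,c) with (a,c) <> (0,0) commutes with v(a',b',c') iff
    (a',c') is a multiple of (a,c).  Hence the commuting graph and its complement
    are regular, and for an r-regular graph M_1 = r^2 |v| and M_2 = r^2 |e| with
    2 |e| = r |v|. *)
Require Import Defs.
From HB Require Import structures.
From mathcomp Require Import all_boot all_order all_algebra all_fingroup all_solvable.
From mathcomp Require Import ring.

Import GRing.Theory.
Local Open Scope ring_scope.

(** * Zagreb indices of regular graphs *)

Section RegularGraph.
Local Open Scope nat_scope.
Implicit Type Gam : sgraph.

Lemma sedgesP Gam (e : {set Gam}) :
  reflect (exists x y, sadj x y /\ e = [set x; y]) (e \in sedges Gam).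
Proof.
apply: (iffP imset2P) => [[x y _]|[x [y [xy ->]]]].
  by rewrite inE => /andP[_ xy] ->; exists x, y.
by exists x y; rewrite ?inE.
Qed.

Lemma card_sedge Gam (e : {set Gam}) : e \in sedges Gam -> #|e| = 2.
Proof.
case/sedgesP=> x [y [xy ->]]; rewrite cards2.
by case: eqVneq xy => // ->; rewrite sadj_irrefl.
Qed.

(** Since adjacency is irreflexive, [y] can be recovered from the pair {x, y}, so neighbours of [x]
    correspond to edges through [x]. *)
Lemma sdeg_incident Gam (x : Gam) : sdeg x = #|[set e in sedges Gam | x \in e]|.
Proof.
rewrite /sdeg -(@card_in_imset _ _ (fun y => [set x; y])); last first.
  move=> y z; rewrite !inE => xy xz /setP/(_ y); rewrite !inE eqxx orbT.
  case: eqVneq => [yx|_] /= /esym/eqP // _.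
  by rewrite yx sadj_irrefl in xy.
apply: eq_card => e; rewrite inE; apply/imsetP/andP => [[y]|[]].
  by rewrite inE => xy ->; rewrite !inE eqxx; split=> //; apply/sedgesP; exists x, y.
case/sedgesP=> u [v [uv ->]]; rewrite !inE => /orP[]/eqP->.
  by exists v; rewrite ?inE.
by exists u; rewrite ?inE 1?setUC // sadj_sym.
Qed.

(** Double counting of incident vertex-edge pairs: after exchanging the sums, each edge contributes
    its two endpoints. *)
Lemma handshake Gam : \sum_(x : Gam) sdeg x = #|sedges Gam| * 2.
Proof.
under eq_bigr => x _ do rewrite sdeg_incident -sum1dep_card big_mkcondr.
rewrite exchange_big /= -sum_nat_const; apply: eq_bigr => e /card_sedge <-.
by rewrite -big_mkcond sum1_card.
Qed.

Variables (Gam : sgraph) (r : nat).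
Hypothesis reg : forall x : Gam, sdeg x = r.

Lemma regular_handshake : #|sedges Gam| * 2 = #|Gam| * r.
Proof. by rewrite -handshake (eq_bigr (fun=> r)) ?sum_nat_const. Qed.

Lemma regular_zagreb1 : zagreb1 Gam = #|Gam| * r ^ 2.
Proof.
by rewrite /zagreb1 (eq_bigr (fun=> r ^ 2)) ?sum_nat_const // => x _; rewrite reg.
Qed.

Lemma regular_zagreb2 : zagreb2 Gam = #|sedges Gam| * r ^ 2.
Proof.
rewrite /zagreb2 -sum_nat_const; apply: eq_bigr => e /card_sedge ce.
by rewrite (eq_bigr (fun=> r)) ?prod_nat_const ?ce.
Qed.

Lemma regular_zagreb2_half (R : numFieldType) :
  ((zagreb2 Gam)%:R = #|Gam|%:R * r%:R ^+ 3 / 2 :> R)%R.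
Proof.
apply: (canRL (mulfK _)); first by rewrite Num.Theory.pnatr_eq0.
rewrite -natrM regular_zagreb2 mulnAC regular_handshake -mulnA -expnS.
by rewrite natrM natrX.
Qed.

Lemma regular_zagreb_ratio (R : numFieldType) :
  ((zagreb2 Gam)%:R / #|sedges Gam|%:R = (zagreb1 Gam)%:R / #|Gam|%:R :> R)%R.
Proof.
rewrite regular_zagreb1 regular_zagreb2 !natrM.
have := regular_handshake.
(* Both quotients equal r^2 when [Gam] has a vertex and r > 0. In the two degenerate cases both
   sides are 0, division by zero giving 0. *)
case: (posnP #|Gam|) => [->|N_gt0].
  by case: #|_| => // _; rewrite !mul0r.
case: (posnP r) => [->|r_gt0]; first by rewrite !mulr0 !mul0r.
move=> E; have e_gt0 : 0 < #|sedges Gam|.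
  by have: 0 < #|sedges Gam| * 2; [rewrite E muln_gt0 N_gt0 | case: #|_|].
by rewrite ![(#|_|%:R * _)%R]mulrC !mulfK // Num.Theory.pnatr_eq0 -lt0n.
Qed.

End RegularGraph.

(** The successor counts [x] itself, which is a neighbour of [x] in neither graph. *)
Lemma sdeg_complement (Gam : sgraph) (x : Gam) :
  (@sdeg (complement Gam) x + (sdeg x).+1 = #|Gam|)%N.
Proof.
rewrite -(cardsC (x |: [set y | sadj x y])) addnC cardsU1 inE sadj_irrefl.
rewrite add1n; congr (_ + _)%N; apply: eq_card => y.
by rewrite !inE /= eq_sym negb_or.
Qed.

(** * Degrees in a commuting graph from centralizer orders *)

Section CommutingGraph.
Local Open Scope group_scope.
Variables (gT : finGroupType) (G : {group gT}).

Lemma card_noncentral : (#|noncentral G| + #|'Z(G)| = #|G|)%N.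
Proof.
rewrite card_sig -(cardsID 'Z(G) G) (setIidPr (center_sub G)) addnC.
by congr (_ + _)%N; apply: eq_card => x; rewrite !inE.
Qed.

(** The centralizer of [x] splits into the centre, [x] itself and the neighbours of [x]. *)
Lemma sdeg_commuting (x : commuting_graph G) :
  ((@sdeg (commuting_graph G) x).+1 + #|'Z(G)| = #|'C_G[val x]|)%N.
Proof.
have xGZ := valP x; have /setDP[xG xZ] := xGZ.
have ZC : 'Z(G) \subset 'C_G[val x].
  by rewrite setIS // -cent_set1 centS // sub1set.
rewrite -(cardsID 'Z(G) 'C_G[val x]) (setIidPr ZC) addnC; congr (_ + _)%N.
rewrite (cardsD1 (val x)) inE xZ inE xG cent1id add1n; congr _.+1.
rewrite /sdeg -(card_imset _ val_inj); apply: eq_card => g.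
apply/imsetP/idP => [[y]|].
  rewrite inE => /andP[xy /eqP cxy] ->.
  have /setDP[yG yZ] := valP y.
  by rewrite in_setD1 in_setD yZ [_ \in 'C_G[_]]in_setI yG eq_sym (inj_eq val_inj) xy; apply/cent1P.
rewrite in_setD1 in_setD [g \in 'C_G[_]]in_setI => /and4P[gx gZ gG /cent1P cgx].
have gGZ : g \in G :\: 'Z(G) by rewrite inE gZ.
exists (Sub g gGZ) => //=; rewrite inE /= /commuting_adj /= cgx eqxx andbT.
by apply: contra gx => /eqP->.
Qed.

End CommutingGraph.

(** * Centre and centralizers of A(n,p) in coordinates *)

Section GroupA.
Variable F : finFieldType.

Lemma vmx_unit (a b c : F) : vmx a b c \in unitmx.
Proof.
(* The inverse is read off [vmxM]: its corner entry must cancel b - ca. *)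
have [] := @mulmx1_unit _ _ (vmx a b c) (vmx (- a) (c * a - b) (- c)) => //.
by rewrite vmxM -vmx1; congr vmx; ring.
Qed.

Lemma vmx_inj (a b c a' b' c' : F) :
  vmx a b c = vmx a' b' c' -> [/\ a = a', b = b' & c = c'].
Proof.
move/matrixP=> E; split.
- by have := E (inord 1) (inord 0); rewrite !mxE !inordK.
- by have := E (inord 2) (inord 0); rewrite !mxE !inordK.
- by have := E (inord 2) (inord 1); rewrite !mxE !inordK.
Qed.

Definition vgl (t : F * F * F) : {'GL_3[F]} :=
  let: (a, b, c) := t in FinRing.unit 'M[F]_3 (vmx_unit a b c).

Local Open Scope group_scope.

Lemma vgl_inj : injective vgl.
Proof.
by move=> [[a b] c] [[a' b'] c'] /(congr1 (@GLval _ _)) /vmx_inj[-> -> ->].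
Qed.

Lemma A_groupE : A_group F = vgl @: setT :> {set _}.
Proof.
apply/setP=> g; rewrite inE; apply/existsP/imsetP.
  move=> [a /existsP[b /existsP[c /eqP E]]].
  by exists (a, b, c) => //; apply: val_inj.
move=> [[[a b] c] _ ->]; exists a; apply/existsP; exists b; apply/existsP.
by exists c; apply/eqP.
Qed.

Lemma vgl_in t : vgl t \in A_group F.
Proof. by rewrite A_groupE imset_f. Qed.

Lemma vglM a b c a' b' c' :
  vgl (a, b, c) * vgl (a', b', c') = vgl (a + a', b + c * a' + b', c + c')%R.
Proof. by apply: val_inj; rewrite /= -[RHS]vmxM. Qed.

(** The two products can differ only in the corner entry, by ca' against c'a: the condition is the
    vanishing of the determinant of (a, c) and (a', c'). *)
Lemma vgl_cent1 a b c a' b' c' :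
  (vgl (a', b', c') \in 'C[vgl (a, b, c)]) = (c * a' == c' * a)%R.
Proof.
apply/cent1P/eqP; rewrite /commute !vglM.
  move=> /vgl_inj[_ E _].
  by apply: (addrI b); apply: (addIr b'); rewrite -E; ring.
by move=> E; congr (vgl (_, _, _)); rewrite ?E; ring.
Qed.

Lemma card_A_group : #|A_group F| = (#|F| ^ 3)%N.
Proof.
rewrite A_groupE card_imset; last exact: vgl_inj.
by rewrite cardsT !card_prod !expnS muln1 mulnA.
Qed.

Lemma vgl_center a b c :
  (vgl (a, b, c) \in 'Z(A_group F)) = (a == 0%R) && (c == 0%R).
Proof.
rewrite inE vgl_in; apply/centP/andP => [cent|[/eqP-> /eqP->] g].
  have E a' c' : (c * a' == c' * a)%R.
    rewrite -(vgl_cent1 a b c a' 0%R); apply/cent1P.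
    by apply/commute_sym/cent; apply: vgl_in.
  (* Testing against (1, 0) forces c = 0, and against (0, 1) forces a = 0. *)
  have := E 1%R 0%R; have := E 0%R 1%R.
  by rewrite mulr0 mul1r mulr1 mul0r eq_sym => -> ->.
rewrite A_groupE => /imsetP[[[a' b'] c'] _ ->].
by apply/cent1P; rewrite vgl_cent1 mulr0 mul0r.
Qed.

Lemma card_center_A : #|'Z(A_group F)| = #|F|.
Proof.
have vinj : injective (fun b => vgl (0%R, b, 0%R)) by move=> b b' /vgl_inj[].
rewrite -[RHS]cardsT -(card_imset _ vinj); apply: eq_card => g.
apply/idP/imsetP => [gZ|[b _ ->]]; last by rewrite vgl_center eqxx.
have := subsetP (center_sub _) g gZ; rewrite A_groupE => /imsetP[[[a b] c] _ E].
move: gZ; rewrite E vgl_center => /andP[/eqP-> /eqP->].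
by exists b.
Qed.

(** One factor q counts the multiples of (a, c), the other the free corner entry; [f] parametrizes
    the centralizer by these two data. *)
Lemma card_cent1_A g :
  g \in A_group F :\: 'Z(A_group F) -> #|'C_(A_group F)[g]| = (#|F| ^ 2)%N.
Proof.
case/setDP; rewrite {1}A_groupE => /imsetP[[[a b] c] _ ->].
rewrite vgl_center negb_and => ac0.
pose f (sb : F * F) := vgl (sb.1 * a, sb.2, sb.1 * c)%R.
have finj : injective f.
  move=> [s d] [s' d'] /vgl_inj[/= Ea -> Ec]; congr (_, _).
  by case/orP: ac0 => nz; apply: (mulIf nz).
rewrite -mulnn -card_prod -cardsT -(card_imset _ finj); apply: eq_card => h.
rewrite inE; apply/andP/imsetP => [[]|[[s d] _ ->]]; last first.
  by rewrite vgl_in vgl_cent1 /=; split=> //; apply/eqP; ring.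
rewrite A_groupE => /imsetP[[[a' b'] c'] _ ->]; rewrite vgl_cent1 => /eqP E.
(* The multiplier is found by dividing by whichever of a, c is nonzero; the relation [E] then gives
   the other coordinate. *)
case/orP: ac0 => nz.
  exists (a' / a, b')%R => //; congr (vgl (_, _, _)) => /=; first by rewrite divfK.
  by apply: (mulIf nz); rewrite -E mulrAC divfK // mulrC.
exists (c' / c, b')%R => //; congr (vgl (_, _, _)) => /=; last by rewrite divfK.
by apply: (mulIf nz); rewrite mulrAC divfK // -E mulrC.
Qed.

Lemma card_commuting_A : (#|commuting_graph (A_group F)| + #|F| = #|F| ^ 3)%N.
Proof. by rewrite -card_A_group -(card_noncentral _ (A_group F)) card_center_A. Qed.

Lemma sdeg_commuting_A (x : commuting_graph (A_group F)) :
  ((@sdeg (commuting_graph (A_group F)) x).+1 + #|F| = #|F| ^ 2)%N.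
Proof. by rewrite -(card_cent1_A _ (valP x)) -sdeg_commuting card_center_A. Qed.

(** The non-neighbours of [x], together with [x] and the centre, make up its centralizer, of order
    q^2. *)
Lemma sdeg_noncommuting_A (x : noncommuting_graph (A_group F)) :
  (@sdeg (noncommuting_graph (A_group F)) x + #|F| ^ 2 = #|F| ^ 3)%N.
Proof.
by rewrite -(sdeg_commuting_A x) addnA sdeg_complement card_commuting_A.
Qed.

End GroupA.

(** The identities live in [rat] because p^n - 3 is negative when p^n = 2 and the halves and ratios
    call for exact division. *)
Theorem theorem2p16 (p n : nat) (F : finFieldType)
  (p_prime : prime p) (n_gt0 : (0 < n)%N) (cardF : #|F| = (p ^ n)%N) :
  let C := commuting_graph (A_group F) in
  let NC := noncommuting_graph (A_group F) in
  [/\ (zagreb1 C)%:R = p%:R ^+ n * (p%:R ^+ (2 * n) - 1)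
          * (p%:R ^+ (2 * n) - p%:R ^+ n - 1) ^+ 2 :> rat,
      (zagreb2 C)%:R = p%:R ^+ n * (p%:R ^+ (2 * n) - 1)
          * (p%:R ^+ (2 * n) - p%:R ^+ n - 1) ^+ 3 / 2 :> rat,
      (zagreb1 NC)%:R = p%:R ^+ (8 * n) * (p%:R ^+ n - 2)
          + p%:R ^+ (5 * n) * (2 * p%:R ^+ n - 1) :> rat,
      (zagreb2 NC)%:R = (p%:R ^+ (3 * n) - p%:R ^+ n)
          * (p%:R ^+ (8 * n) * (p%:R ^+ n - 3)
             + p%:R ^+ (6 * n) * (3 * p%:R ^+ n - 1)) / 2 :> rat &
      forall Gam : sgraph, Gam = C \/ Gam = NC ->
        (zagreb2 Gam)%:R / #|sedges Gam|%:R
          = (zagreb1 Gam)%:R / #|Gam|%:R :> rat].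
Proof.
move=> C NC.
have regC (x : C) : sdeg x = (#|F| ^ 2 - #|F| - 1)%N.
  by rewrite -(sdeg_commuting_A _ x) addnK subn1.
have regNC (x : NC) : sdeg x = (#|F| ^ 3 - #|F| ^ 2)%N.
  by rewrite -(sdeg_noncommuting_A _ x) addnK.
pose q : rat := p%:R ^+ n.
have qE : #|F|%:R = q by rewrite cardF natrX.
have F_gt1 : (1 < #|F|)%N by rewrite -(exp1n n) cardF ltn_exp2r // prime_gt1.
have NE : #|C|%:R = q ^+ 3 - q.
  by rewrite -qE -natrX -card_commuting_A natrD addrK.
(* Truncated subtraction agrees with subtraction in [rat] here, because q > 1 gives q < q^2. *)
have rC : (#|F| ^ 2 - #|F| - 1)%:R = q ^+ 2 - q - 1.
  rewrite !natrB ?natrX ?qE //.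
    by rewrite -mulnn leq_pmulr // ltnW.
  by rewrite subn_gt0 -mulnn ltn_Pmulr // ltnW.
have rNC : (#|F| ^ 3 - #|F| ^ 2)%:R = q ^+ 3 - q ^+ 2.
  by rewrite natrB ?natrX ?qE // leq_exp2l.
(* With each p^(kn) written as q^k, the four formulas become polynomial identities in q. *)
rewrite ![(_ * n)%N]mulnC !exprM -/q; split.
- by rewrite (regular_zagreb1 _ _ regC) natrM natrX NE rC; ring.
- by rewrite (regular_zagreb2_half _ _ regC) NE rC; congr (_ / _); ring.
(* [NE] also applies to [NC], since the complement keeps the vertex type. *)
- by rewrite (regular_zagreb1 _ _ regNC) natrM natrX NE rNC; ring.
- by rewrite (regular_zagreb2_half _ _ regNC) NE rNC; congr (_ / _); ring.
- move=> Gam [] ->; first exact: (regular_zagreb_ratio _ _ regC).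
  exact: (regular_zagreb_ratio _ _ regNC).
Qed.
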